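(* Let $q,a,u,v,x$ be indeterminates (generic parameters). For each integer $m\ge0$ define $H_m$ by $$\frac{(u;q)_m}{(q;q)_m}H_m=\sum_{i=0}^m a^{m-i}\frac{(u;q)_{m-i}}{(q;q)_{m-i}}\ {}_2\phi_1\!\left[\begin{matrix}q^{i-m},\ v\\ q^{1+i-m}/v\end{matrix};q,\frac{q}{v^2a^2}\right]\frac{(x;q)_i}{(q;q)_i}\,\frac{(uq^{m-i};q)_i}{(vq^{m-i+1};q)_i}\,\frac{(v^2q^{2m-i+1};q)_i}{(xv^2q^{2m-i};q)_i}.$$ Then for every integer $r\ge0$, $$a^r\frac{(u;q)_r}{(q;q)_r}\ {}_2\phi_1\!\left[\begin{matrix}q^{-r},\ v\\ q^{1-r}/v\end{matrix};q,\frac{q}{v^2a^2}\right]=\sum_{i=0}^r\frac{(u;q)_{r-i}}{(q;q)_{r-i}}H_{r-i}\,x^i\,\frac{(1/x;q)_i}{(q;q)_i}\,\frac{(uq^{r-i};q)_i}{(vq^{r-i+1};q)_i}\,\frac{(v^2q^{2r-2i+1};q)_i}{(xv^2q^{2r-2i+1};q)_i}\,\frac{1-v^2q^{2r}}{1-v^2q^{2r-i}}.$$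
   Context: For an indeterminate $b$ and integer $k\ge 0$, $(b;q)_k=\prod_{j=0}^{k-1}(1-bq^j)$. The basic hypergeometric series is ${}_{2}\phi_1\!\left[\begin{matrix}a_1,a_2\\ b_1\end{matrix};q,z\right]=\sum_{i\ge0}\frac{(a_1;q)_i(a_2;q)_i}{(b_1;q)_i}\frac{z^i}{(q;q)_i}$, terminating when a numerator parameter is $q^{-m}$, $m\ge0$ an integer. *)

(* Defs.v *)
From HB Require Import structures.
From mathcomp Require Import all_boot all_order all_algebra.
From mathcomp Require Import mpoly.

Set Implicit Arguments.
Unset Strict Implicit.
Unset Printing Implicit Defensive.

Import Order.TTheory GRing.Theory Num.Theory.
Local Open Scope ring_scope.

Definition qpoch (F : fieldType) (q b : F) (k : nat) : F :=
  \prod_(j < k) (1 - b * q ^+ j).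

Definition phi21_term (F : fieldType) (q a1 a2 b1 z : F) (i : nat) : F :=
  qpoch q a1 i * qpoch q a2 i / qpoch q b1 i * (z ^+ i / qpoch q q i).

(* The series 2phi1 with a1 = q^(-n) terminates: its terms of index i > n are
   zero, since (q^(-n); q)_i contains the factor 1 - q^(-n) q^n.  Its value is
   the sum of the terms of index 0, ..., n; [phi21_terminates] shows that
   cutting off at any later index gives the same value. *)
Definition phi21_upto (F : fieldType) (n : nat) (q a1 a2 b1 z : F) : F :=
  \sum_(i < n.+1) phi21_term q a1 a2 b1 z i.

Lemma phi21_terminates (F : fieldType) (q a2 b1 z : F) (n N : nat) :
    q != 0 -> (n <= N)%N ->
  phi21_upto N q (q ^ (- n%:Z)) a2 b1 z = phi21_upto n q (q ^ (- n%:Z)) a2 b1 z.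
Proof.
move=> q0 /subnKC <-; elim: (N - n)%N => [|k IHk]; first by rewrite addn0.
rewrite addnS /phi21_upto big_ord_recr /= -/(phi21_upto _ _ _ _ _ _) IHk.
rewrite /phi21_term.
suff -> : qpoch q (q ^ (- n%:Z)) (n + k).+1 = 0 by rewrite !mul0r addr0.
have lt_n : (n < (n + k).+1)%N by rewrite ltnS leq_addr.
rewrite /qpoch (bigD1 (Ordinal lt_n)) //= -exprnN mulVf ?expf_neq0 //.
by rewrite subrr mul0r.
Qed.

(* Genericity of the parameters: no denominator in the identities vanishes.  (The
   parameter u occurs in no denominator.)  The factors of (q^(1-n)/v; q)_n are,
   up to units, the 1 - v q^k with k < n. *)
Record generic (F : fieldType) (q a v x : F) : Prop := Generic {
  generic_q0 : q != 0;
  generic_a0 : a != 0;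
  generic_v0 : v != 0;
  generic_x0 : x != 0;
  generic_q : forall k : nat, 1 - q ^+ k.+1 != 0;
  generic_v : forall k : nat, 1 - v * q ^+ k != 0;
  generic_v2 : forall k : nat, 1 - v ^+ 2 * q ^+ k != 0;
  generic_xv2 : forall k : nat, 1 - x * v ^+ 2 * q ^+ k.+1 != 0
}.

Definition indet (K : fieldType) (i : 'I_5) : {fraction {mpoly K[5]}} :=
  tofrac ('X_i : {mpoly K[5]}).

(* Indeterminates are generic: take (q, a, u, v, x) = (X_0, .., X_4) in the
   fraction field of K[X_0, .., X_4]. *)
Lemma generic_indeterminates (K : fieldType) :
  generic (indet K (inord 0)) (indet K (inord 1)) (indet K (inord 3))
          (indet K (inord 4)).
Proof.
pose ev : {rmorphism {mpoly K[5]} -> K} := meval (fun=> 0).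
have evX i : ev ('X_i : {mpoly K[5]}) = 0 by exact: mevalXU.
have indet0 i : indet K i != 0.
  rewrite /indet tofrac_eq0; apply/eqP => /(congr1 (meval (fun=> 1))).
  by rewrite mevalXU meval0; apply/eqP; rewrite oner_eq0.
have neq0 (p : {mpoly K[5]}) : ev p = 0 -> 1 - tofrac p != 0.
  move=> p0; rewrite -tofrac1 -tofracB tofrac_eq0.
  by apply/eqP => /(congr1 ev); rewrite rmorphB rmorph1 p0 rmorph0 subr0;
     apply/eqP; rewrite oner_eq0.
split=> // k.
- by rewrite /indet -tofracXn; apply: neq0; rewrite rmorphXn evX expr0n.
- by rewrite /indet -!(tofracXn, tofracM); apply: neq0; rewrite rmorphM evX mul0r.
- rewrite /indet -!(tofracXn, tofracM); apply: neq0.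
  by rewrite rmorphM rmorphXn evX expr0n mul0r.
- rewrite /indet -!(tofracXn, tofracM); apply: neq0.
  by rewrite !rmorphM evX !mul0r.
Qed.

(* Main.v *)
(** Write P_n for the left-hand side with r = n, and h_m for (u;q)_m/(q;q)_m H_m.
    The definition of H reads h_m = sum_n A(m,n) P_n with A lower triangular, and
    the claim is P_r = sum_m B(r,m) h_m, so the 2phi1 plays no role and it suffices
    that B is the inverse of A.  The factors in u and v are of the form
    f(m)/f(n) and drop out.  What remains is, after shifting the indices by n and
    replacing w = v^2 by w q^(2n), a terminating very-well-poised 6phi5 whose
    parameters make it indefinitely summable: its partial sums are products, and
    the last of them vanishes. *)

Require Import Defs.
From mathcomp Require Import all_boot all_order all_algebra.
From mathcomp Require Import ring zify.
Import GRing.Theory.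
Local Open Scope ring_scope.

Section QPochhammer.
Variables (F : fieldType) (q : F).
Implicit Types (b : F) (k m n : nat).

Lemma qpoch0 b : qpoch q b 0 = 1.
Proof. by rewrite /qpoch big_ord0. Qed.

Lemma qpochD b m n :
  qpoch q b (m + n) = qpoch q b m * qpoch q (b * q ^+ m) n.
Proof.
rewrite /qpoch big_split_ord; congr (_ * _).
by apply: eq_bigr => j _ /=; rewrite exprD mulrA.
Qed.

Lemma qpoch1 b : qpoch q b 1 = 1 - b.
Proof. by rewrite /qpoch big_ord1 expr0 mulr1. Qed.

Lemma qpochSr b k : qpoch q b k.+1 = qpoch q b k * (1 - b * q ^+ k).
Proof. by rewrite -addn1 qpochD qpoch1. Qed.

Lemma qpochSl b k : qpoch q b k.+1 = (1 - b) * qpoch q (b * q) k.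
Proof. by rewrite -add1n qpochD qpoch1 expr1. Qed.

Lemma qpoch_neq0 b k :
  (forall j, 1 - b * q ^+ j != 0) -> qpoch q b k != 0.
Proof. by move=> nz; apply/prodf_neq0 => j _. Qed.

End QPochhammer.

Section InversePair.
Variables (F : fieldType) (q w x : F).

(** With w = v^2 this is the coefficient of P_n in h_m, cleared of its factors in u and v. The
    summation index i of the theorem is m - n here and r - m in [pairB]. *)
Definition pairA (m n : nat) : F :=
  qpoch q x (m - n) / qpoch q q (m - n)
  * (qpoch q (w * q ^+ (m + n + 1)) (m - n)
     / qpoch q (x * w * q ^+ (m + n)) (m - n)).

Definition pairB (r m : nat) : F :=
  x ^+ (r - m) * (qpoch q (1 / x) (r - m) / qpoch q q (r - m))
  * (qpoch q (w * q ^+ (2 * m + 1)) (r - m)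
     / qpoch q (x * w * q ^+ (2 * m + 1)) (r - m))
  * ((1 - w * q ^+ (2 * r)) / (1 - w * q ^+ (r + m))).

Hypothesis x0 : x != 0.
Hypothesis hq : forall k : nat, 1 - q ^+ k.+1 != 0.
Hypothesis hw : forall k : nat, 1 - w * q ^+ k != 0.
Hypothesis hxw : forall k : nat, 1 - x * w * q ^+ k.+1 != 0.

Let qq_neq0 k : qpoch q q k != 0.
Proof. by apply: qpoch_neq0 => j; rewrite -exprS. Qed.

Let xw_neq0 i k : qpoch q (x * w * q ^+ i.+1) k != 0.
Proof. by apply: qpoch_neq0 => j; rewrite -mulrA -exprD addSn. Qed.

(* With N = n + p the summand is that of the very-well-poised 6phi5 with a = x w,
   b = x, c = w q^N, d = q^(-N) and argument q; since a = bcd it telescopes.  The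
   factor 1 - x w may vanish: it cancels from the term k = 0, which is why the
   summands are kept as products of entries. *)
Lemma pair_partial_sum (n p : nat) : (0 < n + p)%N ->
  \sum_(0 <= k < n.+1) pairB (n + p) k * pairA k 0 =
  (1 - q ^+ p) * (1 - w * q ^+ (2 * (n + p)))
  / ((1 - q ^+ (n + p)) * (1 - w * q ^+ (n + p)))
  * (qpoch q (x * q) n / qpoch q q n)
  * (x ^+ p * (qpoch q (1 / x) p / qpoch q q p))
  * (qpoch q (w * q ^+ n.+1) (n + p) / qpoch q (x * w * q ^+ n.+1) (n + p)).
Proof.
(* N = n + p stays fixed in the induction: passing from n to n + 1 lowers p by one, so [IHn] is used
   at [p.+1]. *)
elim: n p => [|n IHn] p Np.
  (* Here p > 0 lets 1 - q^p cancel; for n = p = 0 the sum is 1 but the closed form is 0. *)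
  rewrite big_nat1 /pairA /pairB !add0n addn0 subn0 ?muln0 !qpoch0.
  rewrite expr1 divr1 !mul1r mulr1; case: p Np => // p _.
  have := hq p; have := hw p.+1; have := xw_neq0 0 p.+1; have := qq_neq0 p.+1.
  rewrite expr1 => *; field.
  by repeat (apply/andP; split).
rewrite big_nat_recr //= addSnnS IHn; last by rewrite addnS.
rewrite /pairA /pairB.
have -> : (n + p.+1 - n.+1 = p)%N by lia.
rewrite subn0 addn0.
(* The exponents of the two products abut and run from n + 2 to 2n + p + 2; the last factor cancels
   a denominator of [pairB]. *)
have eB : qpoch q (w * q ^+ (n.+1 + 1)) n.+1 * qpoch q (w * q ^+ (2 * n.+1 + 1)) p
    = qpoch q (w * q ^+ n.+2) (n + p) * (1 - w * q ^+ (n + p.+1 + n.+1)).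
  have -> : w * q ^+ (2 * n.+1 + 1) = w * q ^+ (n.+1 + 1) * q ^+ n.+1.
    by rewrite -mulrA -exprD; congr (_ * _ ^+ _); lia.
  rewrite -qpochD (addSn n p) qpochSr addn1 -mulrA -exprD.
  by congr (_ * (1 - _ * _ ^+ _)); lia.
(* The denominators skip the exponent 2n + 2; filling this gap puts the very-well-poised factor 1 -
   x w q^(2n+2) into the numerator. *)
have eD : qpoch q (x * w * q ^+ n.+1) n.+1 * (1 - x * w * q ^+ (2 * n.+1))
      * qpoch q (x * w * q ^+ (2 * n.+1 + 1)) p
    = (1 - x * w * q ^+ n.+1) * qpoch q (x * w * q ^+ n.+2) (n + p)
      * (1 - x * w * q ^+ (n + p.+1 + n.+1)).
  have -> : x * w * q ^+ (2 * n.+1) = x * w * q ^+ n.+1 * q ^+ n.+1.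
    by rewrite -(mulrA (x * w)) -exprD addnn -mul2n.
  have -> : x * w * q ^+ (2 * n.+1 + 1) = x * w * q ^+ n.+1 * q ^+ n.+2.
    by rewrite -(mulrA (x * w)) -exprD; congr (_ * _ ^+ _); lia.
  rewrite -qpochSr -qpochD (_ : (n.+2 + p = (n + p).+2)%N) // qpochSl qpochSr.
  rewrite -!(mulrA (x * w)) -exprSr -exprD mulrA.
  by congr (_ * (1 - _ * _ ^+ _)); lia.
have eG : qpoch q (w * q ^+ n.+1) (n + p.+1)
    = (1 - w * q ^+ n.+1) * qpoch q (w * q ^+ n.+2) (n + p).
  by rewrite addnS qpochSl -mulrA -exprSr.
have eH : qpoch q (x * w * q ^+ n.+1) (n + p.+1)
    = (1 - x * w * q ^+ n.+1) * qpoch q (x * w * q ^+ n.+2) (n + p).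
  by rewrite addnS qpochSl -(mulrA (x * w)) -exprSr.
have eG' : qpoch q (w * q ^+ n.+2) (n + p.+1)
    = qpoch q (w * q ^+ n.+2) (n + p) * (1 - w * q ^+ (n + p.+1 + n.+1)).
  rewrite addnS qpochSr -mulrA -exprD.
  by congr (_ * (1 - _ * _ ^+ _)); lia.
have eH' : qpoch q (x * w * q ^+ n.+2) (n + p.+1)
    = qpoch q (x * w * q ^+ n.+2) (n + p) * (1 - x * w * q ^+ (n + p.+1 + n.+1)).
  rewrite addnS qpochSr -(mulrA (x * w)) -exprD.
  by congr (_ * (1 - _ * _ ^+ _)); lia.
have nxw1 : 1 - x * w * q ^+ (2 * n.+1) != 0 by exact: hxw.
have nD1 : qpoch q (x * w * q ^+ n.+1) n.+1 != 0 by exact: xw_neq0.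
have nD2 : qpoch q (x * w * q ^+ (2 * n.+1 + 1)) p != 0.
  by rewrite addn1; exact: xw_neq0.
have nZ := xw_neq0 n.+1 (n + p).
have nE : 1 - x * w * q ^+ (n + p.+1 + n.+1) != 0 by rewrite addnS; exact: hxw.
have nE2 := hw (n + p.+1 + n.+1).
have nxw2 := hxw n.
rewrite eG eH eG' eH'.
(* [T] is the new summand k = n + 1, rewritten over the Pochhammer symbols that it shares with the
   two partial sums. *)
set T := _ * (_ * (qpoch q (w * q ^+ (n.+1 + 1)) n.+1 / _)).
have -> : T = (1 - x) * qpoch q (x * q) n / (qpoch q q n * (1 - q ^+ n.+1))
   * (x ^+ p * (qpoch q (1 / x) p / qpoch q q p))
   * (1 - w * q ^+ (2 * (n + p.+1))) * qpoch q (w * q ^+ n.+2) (n + p)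
   * (1 - x * w * q ^+ (2 * n.+1))
   / ((1 - x * w * q ^+ n.+1) * qpoch q (x * w * q ^+ n.+2) (n + p)
      * (1 - x * w * q ^+ (n + p.+1 + n.+1))).
  rewrite -eD /T qpochSl [qpoch q q n.+1]qpochSr -exprS.
  have eB' : qpoch q (w * q ^+ n.+2) (n + p) =
    qpoch q (w * q ^+ (n.+1 + 1)) n.+1 * qpoch q (w * q ^+ (2 * n.+1 + 1)) p
     / (1 - w * q ^+ (n + p.+1 + n.+1)) by rewrite eB mulfK.
  rewrite eB'.
  have n1 := hq n; have n2 := qq_neq0 n; have n3 := qq_neq0 p.
  move: nD1 nD2 nxw1 nE2 n1 n2 n3.
  move: (qpoch q (x * w * _) n.+1) (qpoch q (x * w * _) p) (qpoch q (w * _) n.+1)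
    (qpoch q (w * _) p) (1 - x * w * _) (1 - w * q ^+ (n + p.+1 + _))
    (1 - q ^+ _) (1 - w * q ^+ _) => *.
  by field; repeat (apply/andP; split).
rewrite [qpoch q (x * q) n.+1]qpochSr [qpoch q q n.+1]qpochSr
   [qpoch q q p.+1]qpochSr [qpoch q (1 / x) p.+1]qpochSr [x ^+ p.+1]exprS.
have n1 := hq n; have n2 := qq_neq0 n; have n3 := qq_neq0 p.
have n4 := hq p; have n5 := hq (n + p); have n6 := hw (n + p).+1.
move: nZ n2 n3 n1 n4 n5 n6 nE nxw2.
move: (qpoch q (x * q) n) (qpoch q q n) (qpoch q (1 / x) p) (qpoch q q p)
  (qpoch q (w * q ^+ n.+2) _) (qpoch q (x * w * q ^+ n.+2) _) => a1 a2 a3 a4 a5 a6.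
(* With the common symbols abstracted, a rational identity in q^n, q^p, x^p, q, w and x remains. *)
rewrite !mul2n -!addnn ?addnS ?addSn !exprS !exprD.
move: (q ^+ n) (q ^+ p) (x ^+ p) => X Y Z *; field.
by repeat (apply/andP; split).
Qed.

End InversePair.

Arguments pairA {F} q w x m n.
Arguments pairB {F} q w x r m.

(** The indices enter only through m - n and w q^(m+n), so a common shift by n is absorbed into w;
    likewise for [pairB]. *)
Lemma pairA_shift (F : fieldType) (q w x : F) (n k : nat) :
  pairA q w x (k + n) n = pairA q (w * q ^+ (2 * n)) x k 0.
Proof.
rewrite /pairA addnK subn0 -!mulrA -!exprD.
by congr (_ * (_ * (qpoch _ (_ * _ ^+ _) _ / qpoch _ (_ * (_ * _ ^+ _)) _))); lia.
Qed.

Lemma pairB_shift (F : fieldType) (q w x : F) (n r m : nat) :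
  pairB q w x (r + n) (m + n) = pairB q (w * q ^+ (2 * n)) x r m.
Proof.
rewrite /pairB subnDr -!mulrA -!exprD.
congr (_ * (_ * (_ * (qpoch _ (_ * _ ^+ _) _ * ((qpoch _ (_ * (_ * _ ^+ _)) _)^-1
  * ((1 - _ * _ ^+ _) * (1 - _ * _ ^+ _)^-1)))))); lia.
Qed.

(** Off the diagonal, shifting to n = 0 gives the complete sum, the case p = 0 of
    [pair_partial_sum], which its factor 1 - q^p kills. *)
Lemma pair_orthogonality (F : fieldType) (q w x : F) (n r : nat) :
    x != 0 -> (forall k : nat, 1 - q ^+ k.+1 != 0) ->
    (forall k : nat, 1 - w * q ^+ k != 0) ->
    (forall k : nat, 1 - x * w * q ^+ k.+1 != 0) -> (n <= r)%N ->
  \sum_(n <= m < r.+1) pairB q w x r m * pairA q w x m n = (n == r)%:R.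
Proof.
move=> x0 hq hw hxw le_nr; case: eqVneq => [->|ne_nr].
  rewrite big_nat1 /pairA /pairB subnn !qpoch0 addnn -mul2n.
  by rewrite expr0 !divr1 !mulr1 mul1r divff.
have [s ->] : exists s, r = (s.+1 + n)%N.
  by exists (r - n).-1; move/eqP: ne_nr; lia.
rewrite -addSn -{1}[n]add0n big_addn addnK.
under eq_bigr do rewrite pairA_shift pairB_shift.
have := @pair_partial_sum _ q (w * q ^+ (2 * n)) x x0 hq _ _ s.+1 0.
rewrite addn0 subrr !mul0r; apply=> // k; first by rewrite -mulrA -exprD.
by rewrite mulrA -(mulrA (x * w)) -exprD addnS.
Qed.

Lemma exchange_big_triangle (V : nmodType) (r : nat) (f : nat -> nat -> V) :
  \sum_(0 <= m < r.+1) \sum_(0 <= n < m.+1) f m n =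
  \sum_(0 <= n < r.+1) \sum_(n <= m < r.+1) f m n.
Proof.
elim: r => [|r IHr]; first by rewrite !big_nat1.
rewrite big_nat_recr //= IHr [RHS]big_nat_recr //= big_nat1.
rewrite [in LHS](big_nat_recr r.+1) //= addrA -big_split /=; congr (_ + _).
rewrite big_nat [RHS]big_nat; apply: eq_bigr => n /andP[_ lt_n].
by rewrite [RHS]big_nat_recr //= ltnW.
Qed.

(** Generically f(m)/f(n) with f(k) = (u;q)_k / (vq;q)_k; this form avoids dividing by (u;q)_n,
    which may vanish. *)
Definition uv_ratio {F : fieldType} (q u v : F) (m n : nat) : F :=
  qpoch q (u * q ^+ n) (m - n) / qpoch q (v * q ^+ (n + 1)) (m - n).

(** Consecutive products concatenate, so the factors in u and v leave the sum over m. *)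
Lemma uv_ratio_trans (F : fieldType) (q u v : F) (r m n : nat) :
    (n <= m)%N -> (m <= r)%N ->
  uv_ratio q u v m n * uv_ratio q u v r m = uv_ratio q u v r n.
Proof.
move=> le_nm le_mr; rewrite /uv_ratio mulrACA -invfM.
have -> : (r - n = (m - n) + (r - m))%N by lia.
rewrite !qpochD -(mulrA u) -(mulrA v) -!exprD.
by congr (_ * qpoch _ (_ * _ ^+ _) _ / (_ * qpoch _ (_ * _ ^+ _) _)); lia.
Qed.

Theorem theorem3 (F : fieldType) (q a u v x : F) (H : nat -> F)
    (hgen : generic q a v x)
    (hH : forall m : nat,
      qpoch q u m / qpoch q q m * H m =
      \sum_(0 <= i < m.+1)
        a ^+ (m - i) * (qpoch q u (m - i) / qpoch q q (m - i))
        * phi21_upto (m - i) q (q ^ (i%:Z - m%:Z)) v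
            (q ^ (1 + i%:Z - m%:Z) / v) (q / (v ^+ 2 * a ^+ 2))
        * (qpoch q x i / qpoch q q i)
        * (qpoch q (u * q ^+ (m - i)) i / qpoch q (v * q ^+ (m - i + 1)) i)
        * (qpoch q (v ^+ 2 * q ^+ (2 * m - i + 1)) i
           / qpoch q (x * v ^+ 2 * q ^+ (2 * m - i)) i))
    (r : nat) :
  a ^+ r * (qpoch q u r / qpoch q q r)
    * phi21_upto r q (q ^ (- r%:Z)) v
        (q ^ (1 - r%:Z) / v) (q / (v ^+ 2 * a ^+ 2))
  = \sum_(0 <= i < r.+1)
      qpoch q u (r - i) / qpoch q q (r - i) * H (r - i)%N
      * x ^+ i * (qpoch q (1 / x) i / qpoch q q i)
      * (qpoch q (u * q ^+ (r - i)) i / qpoch q (v * q ^+ (r - i + 1)) i)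
      * (qpoch q (v ^+ 2 * q ^+ (2 * r - 2 * i + 1)) i
         / qpoch q (x * v ^+ 2 * q ^+ (2 * r - 2 * i + 1)) i)
      * ((1 - v ^+ 2 * q ^+ (2 * r)) / (1 - v ^+ 2 * q ^+ (2 * r - i))).
Proof.
case: hgen => q0 a0 v0 x0 hq hv hv2 hxv2.
pose P n := a ^+ n * (qpoch q u n / qpoch q q n)
  * phi21_upto n q (q ^ (- n%:Z)) v (q ^ (1 - n%:Z) / v) (q / (v ^+ 2 * a ^+ 2)).
(* Reversing the sum, i = m - n, exhibits the definition of H as a lower triangular system. *)
have hP m : qpoch q u m / qpoch q q m * H m =
    \sum_(0 <= n < m.+1) P n * (pairA q (v ^+ 2) x m n * uv_ratio q u v m n).
  rewrite hH big_nat_rev big_nat [RHS]big_nat; apply: eq_bigr => n /andP[_ le_n].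
  have -> : (0 + m.+1 - n.+1 = m - n)%N by lia.
  rewrite /P /pairA /uv_ratio subKn //.
  have -> : (2 * m - (m - n) = m + n)%N by lia.
  have -> : (m - n)%:Z - m%:Z = - n%:Z by lia.
  have -> : 1 + (m - n)%:Z - m%:Z = 1 - n%:Z by lia.
  by ring.
rewrite big_nat_rev big_nat.
transitivity (\sum_(0 <= m < r.+1) \sum_(0 <= n < m.+1)
    P n * uv_ratio q u v r n * (pairB q (v ^+ 2) x r m * pairA q (v ^+ 2) x m n));
    last first.
  rewrite big_nat; apply: eq_bigr => m /andP[_ le_m].
  have -> : (0 + r.+1 - m.+1 = r - m)%N by lia.
  rewrite subKn // hP !mulr_suml big_nat [RHS]big_nat.
  apply: eq_bigr => n /andP[_ le_n]; rewrite -(@uv_ratio_trans _ _ _ _ r m n) //.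
  have -> : (2 * r - 2 * (r - m) = 2 * m)%N by lia.
  have -> : (2 * r - (r - m) = r + m)%N by lia.
  by rewrite /pairB /uv_ratio; ring.
(* Summing over m first leaves only n = r, the last term, where [uv_ratio] is 1. *)
rewrite exchange_big_triangle big_nat_recr //= big1_seq ?add0r => [|n].
  rewrite -mulr_sumr pair_orthogonality // eqxx mulr1.
  by rewrite /uv_ratio subnn !qpoch0 divr1 mulr1.
rewrite mem_index_iota /= => lt_nr.
by rewrite -mulr_sumr pair_orthogonality ?(ltnW lt_nr) // ltn_eqF ?mulr0.
Qed.
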